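(* Let $D_{\mathcal A},D_{\mathcal B}>0$, let $\mathcal A$ be a $D_{\mathcal A}$-uniformly regular Tauberian algebra satisfying condition $(M)$, and let $\mathcal B$ be a $D_{\mathcal B}$-uniformly regular semisimple commutative Banach algebra satisfying condition $(M)$. Let $T:\mathcal A\to\mathcal B$ be a bijective separating linear map. Then $T$ is continuous and $\widehat{Ta}(y)=X(y)\,\widehat a(t(y))$ for all $a\in\mathcal A$ and $y\in\Omega_{\mathcal B}$, where the support map $t$ of $T$ is a homeomorphism from $\Omega_{\mathcal B}$ onto $\Omega_{\mathcal A}$, and $X$ is a bounded continuous function on $\Omega_{\mathcal B}$ which is also bounded away from $0$.
   Context: For a commutative Banach algebra $\mathcal{A}$ (over $\mathbb{C}$), $\Omega_{\mathcal{A}}$ is its maximal ideal (character) space with the Gelfand topology, $\widehat{a}$ is the Gelfand transform of $a$, $\operatorname{coz}(\widehat a)=\{x\in\Omega_{\mathcal A}:\widehat a(x)\ne0\}$, and $\operatorname{supp}(\widehat a)$ is its closure. $\mathcal{A}$ is semisimple if $\bigcap_{x\in\Omega_{\mathcal A}}\ker x=\{0\}$. $\mathcal{A}$ is regular if for every $x\in\Omega_{\mathcal A}$ and open neighbourhood $U$ of $x$ there is $a\in\mathcal A$ with $\widehat a(x)=1$ and $\widehat a=0$ on $\Omega_{\mathcal A}\setminus U$. $\mathcal A_c$ is the set of $a\in\mathcal A$ with $\operatorname{supp}(\widehat a)$ compact. A Tauberian algebra is a semisimple commutative Banach algebra $\mathcal A$ in which $\mathcal A_c$ is dense. Condition $(M)$: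 $\mathcal A$ is regular and for each $x\in\Omega_{\mathcal A}$, each $a\in\mathcal A$ with $\widehat a(x)=0$, and each neighbourhood $U$ of $x$, $\inf\{\|ba\|_{\mathcal A}: b\in\mathcal A,\ \widehat b|_V\equiv1 \text{ for some neighbourhood } V \text{ of } x,\ \operatorname{supp}(\widehat b)\subseteq U\}=0$. A regular commutative Banach algebra $\mathcal A$ is $D$-uniformly regular ($D>0$) if for each $x\in\Omega_{\mathcal A}$ and open neighbourhood $U$ of $x$, $\inf\{\|a\|: a\in\mathcal A,\ \widehat a(x)=1,\ \operatorname{supp}\widehat a\subseteq U\}\le D$. A linear map $T:\mathcal A\to\mathcal B$ is separating if $a_1a_2=0$ implies $Ta_1\,Ta_2=0$ for all $a_1,a_2\in\mathcal A$. Let $T:\mathcal A\to\mathcal B$ be separating, with $\mathcal A,\mathcal B$ semisimple regular commutative. $\overline{\Omega}_{\mathcal A}$ is the one-point compactification of $\Omega_{\mathcal A}$. $\Omega_{\mathcal B}'$ is the set of $y\in\Omega_{\mathcal B}$ for which some $a\in\mathcal A$ has $\widehat{Ta}(y)\neq0$. For $y\in\Omega_{\mathcal B}'$ let $\tau_y:\mathcal A\to\mathbb C$, $\tau_y(a)=\widehat{Ta}(y)$. An open $V\subseteq\overline{\Omega}_{\mathcal A}$ is a vanishing set for $\tau_y$ if $\tau_y(a)=0$ for all $a\in\mathcal A$ with $\operatorname{coz}(\widehat a)\subseteq V$. It is known that $\operatorname{supp}(\tau_y):=\overline{\Omega}_{\mathcal A}\setminus\bigcup\{V: V\text{ a vanishing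 set for }\tau_y\}$ is a singleton; the support map $t:\Omega_{\mathcal B}'\to\overline{\Omega}_{\mathcal A}$ sends $y$ to its unique element. The function $X:t^{-1}(\Omega_{\mathcal A})\to\mathbb C$ is defined by $X(y)=\widehat{Ta_U}(y)$, where $U$ is any relatively compact neighbourhood of $t(y)$ and $a_U\in\mathcal A_c$ satisfies $\widehat{a}_U|_U\equiv1$ (this does not depend on the choices). *)

(* Defs.v *)
From HB Require Import structures.
From mathcomp Require Import all_boot all_order all_algebra.
From mathcomp Require Import complex.
From mathcomp Require Import all_classical all_reals.
From mathcomp Require Import ereal topology normedtype.

Set Implicit Arguments.
Unset Strict Implicit.
Unset Printing Implicit Defensive.

Import Order.TTheory GRing.Theory Num.Theory.
Import numFieldNormedType.Exports.

Local Open Scope classical_set_scope.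
Local Open Scope ring_scope.
Local Open Scope complex_scope.

(* The cast gives the complex numbers the topology of their modulus: the
   topological structures are attached to the projection of numFieldType, not
   to the bare type R[i]. *)
Notation Cplx R := (R[i] : numFieldType).

(* No unit is assumed, so the ring structures of MathComp, which are all
   unital, do not apply. The norm takes its values in R[i]; the partial order
   of R[i] compares two elements only when their imaginary parts agree, and
   norms have imaginary part 0. *)
HB.mixin Record CompleteNormedModule_isCommBanachAlgebra (R : realType) A
    & CompleteNormedModule R[i] A := {
  bmul : A -> A -> A ;
  bmulA : associative bmul ;
  bmulC : commutative bmul ;
  bmulDl : left_distributive bmul +%R ;
  bscaleAl : forall (k : R[i]) (a b : A), k *: bmul a b = bmul (k *: a) b ;
  bmul_norm : forall a b : A, `|bmul a b| <= `|a| * `|b|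
}.

#[short(type="commBanachAlgType")]
HB.structure Definition CommBanachAlgebra (R : realType) :=
  {A of CompleteNormedModule R[i] A
      & CompleteNormedModule_isCommBanachAlgebra R A}.

Section BanachAlgebra.
Variables (R : realType) (A : commBanachAlgType R).

Definition rnorm (a : A) : R := complex.Re `|a|.

(* Characters are the nonzero multiplicative linear functionals; they are in
   bijection with the maximal modular ideals through their kernels, and are
   automatically continuous. As a subset of the functions A -> R[i] with the
   product topology, the set carries the topology of pointwise convergence,
   which is the Gelfand topology. *)
Definition characters : set (prod_topology (fun _ : A => Cplx R)) :=
  [set x | [/\ scalar x,
               (forall a b, x (bmul a b) = x a * x b)
             & exists a, x a != 0]].

Definition char_space : topologicalType := set_type characters.

Definition gelfand (a : A) (x : char_space) : Cplx R := (set_val x) a.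

Definition coz (f : char_space -> Cplx R) : set char_space :=
  [set x | f x != 0].

Definition supp (f : char_space -> Cplx R) : set char_space :=
  closure (coz f).

Definition semisimple : Prop :=
  forall a : A, (forall x, gelfand a x = 0) -> a = 0.

Definition regular : Prop :=
  forall (x : char_space) (U : set char_space), open U -> U x ->
  exists a : A, gelfand a x = 1 /\ (forall z, ~ U z -> gelfand a z = 0).

Definition compactly_supported : set A :=
  [set a | compact (supp (gelfand a))].

Definition tauberian : Prop := semisimple /\ dense compactly_supported.

(* The infima below are taken in \bar R, where the empty set has infimum +oo;
   in R it would be 0 by convention. *)
Definition condition_M : Prop :=
  regular /\
  forall (x : char_space) (a : A) (U : set char_space),
    gelfand a x = 0 -> nbhs x U ->
    ereal_inf [set (rnorm (bmul b a))%:E | b in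
      [set b : A | (exists2 V, nbhs x V & forall z, V z -> gelfand b z = 1)
                   /\ supp (gelfand b) `<=` U]] = 0%E.

Definition uniformly_regular (D : R) : Prop :=
  regular /\
  forall (x : char_space) (U : set char_space), open U -> U x ->
    (ereal_inf [set (rnorm a)%:E | a in
      [set a : A | gelfand a x = 1%R /\ supp (gelfand a) `<=` U]] <= D%:E)%E.

End BanachAlgebra.

Section SeparatingMap.
Variables (R : realType) (A B : commBanachAlgType R) (T : A -> B).

Local Notation opcA := (one_point_compactification (char_space A)).

Definition separating : Prop :=
  forall a1 a2 : A, bmul a1 a2 = 0 -> bmul (T a1) (T a2) = 0.

Definition nonvanishing : set (char_space B) :=
  [set y | exists a : A, gelfand (T a) y != 0].

Definition tau (y : char_space B) (a : A) : Cplx R := gelfand (T a) y.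

Definition vanishing_set (phi : A -> Cplx R) (V : set opcA) : Prop :=
  open V /\
  forall a : A, [set Some x | x in coz (gelfand a)] `<=` V -> phi a = 0.

Definition functional_supp (phi : A -> Cplx R) : set opcA :=
  ~` \bigcup_(V in vanishing_set phi) V.

(* Only the restriction of t to nonvanishing is constrained. *)
Definition is_support_map (t : char_space B -> opcA) : Prop :=
  forall y, nonvanishing y -> functional_supp (tau y) = [set t y].

(* The values of T a_U at y, over all U and a_U that may be chosen at x. *)
Definition weight_values (x : char_space A) (y : char_space B) :
    set (Cplx R) :=
  [set gelfand (T a) y | a in
    [set a | compactly_supported a /\
             exists U : set (char_space A),
               [/\ nbhs x U, compact (closure U)
                 & forall z, U z -> gelfand a z = 1]]].

(* The equality of sets says both that a choice of U and a_U exists and that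
   the value does not depend on it. *)
Definition is_weight (t : char_space B -> opcA) (X : char_space B -> Cplx R) :
    Prop :=
  forall y x, nonvanishing y -> t y = Some x -> weight_values x y = [set X y].

End SeparatingMap.

Definition homeomorphism (S1 S2 : topologicalType) (f : S1 -> S2) : Prop :=
  continuous f /\
  exists g : S2 -> S1, [/\ cancel f g, cancel g f & continuous g].

(* Main.v *)
Require Import Defs.
From HB Require Import structures.
From mathcomp Require Import all_boot all_order all_algebra.
From mathcomp Require Import complex.
From mathcomp Require Import all_classical all_reals.
From mathcomp Require Import ereal topology normedtype.
From mathcomp Require Import ring lra.
Import Order.TTheory GRing.Theory Num.Theory.
Import numFieldNormedType.Exports.
Local Open Scope classical_set_scope.
Local Open Scope ring_scope.
Local Open Scope complex_scope.

Set Implicit Arguments.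
Unset Strict Implicit.
Unset Printing Implicit Defensive.

(** Fix [y] in the character space of [B] and look at the functional
    [tau T y : a |-> gelfand (T a) y]. Condition (M) supplies elements of [A]
    whose transform is 1 near a point and lives in a prescribed neighbourhood;
    multiplying by [1 - b] for finitely many such [b] and using compactness of
    the one-point compactification shows that [tau T y] has a support, and
    separation makes that support a single point [s y] ([tau_supp_singleton]).
    Then [tau T y a] depends only on the germ of [gelfand a] at [s y]. If
    moreover [tau T y] is bounded and [s y] is a character [x], the infimum in
    condition (M) lets one multiply an element vanishing at [x] by a local unit
    so as to make it arbitrarily small without changing [tau T y], so that
    [tau T y] is a multiple of evaluation at [x]
    ([functional_bounded_eval]).

    The point is therefore that every [tau T y] is bounded. Bounded ones have
    supports that are dense in the character space of [A]
    ([bounded_support_dense]): injectivity of [T] makes all supports dense, a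
    functional supported at an isolated point is bounded, and if an open set met
    only supports of unbounded functionals, one could pick disjoint open sets
    [U_n] in it, unbounded [tau T y_n] supported in [U_n], and small [a_n] living
    in [U_n] with [tau T y_n (a_n)] large; the transform of the image of the sum
    of the [a_n] would be unbounded. By uniform boundedness the bounded [tau T y]
    share one bound, so they form a closed set of [y]. If some [y] were outside
    it, regularity of [B] and surjectivity of [T] would give a nonzero [T c]
    vanishing on that set; then [gelfand c] vanishes at a dense set of points,
    hence [c = 0] ([tau_bounded]). Since the elements of compactly supported
    transform are dense, a bounded nonzero functional cannot be supported at
    infinity ([support_finite]).

    Thus [T] is a weighted composition operator, [gelfand (T a) y = X y * gelfand
    a (t y)]. The closed graph theorem makes [T] and its inverse bounded, uniform
    regularity supplies elements of bounded norm with value 1 at a given point,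
    and together they bound [X] above and below. The remaining topological
    properties of [t] and [X] are read off the formula.

    Boundedness theorems are derived from one statement, Zabreiko's lemma: on a
    Banach space a countably subadditive seminorm is bounded. *)

(** * Real-valued norms and geometric series *)

Section RealNorm.
Variable R : realType.

(** Norms over [R[i]] take values in [R[i]], whose order is only partial; their
    real parts can be compared by linear arithmetic. *)
Definition nrm (V : normedZmodType R[i]) (v : V) : R := complex.Re `|v|.

Lemma nrmE (V : normedZmodType R[i]) (v : V) : `|v| = (nrm v)%:C.
Proof. by rewrite RRe_real // ger0_real. Qed.

Lemma nrm_ge0 (V : normedZmodType R[i]) (v : V) : 0 <= nrm v.
Proof. by rewrite -ler0c -nrmE. Qed.

Lemma nrm0 (V : normedZmodType R[i]) : nrm (0 : V) = 0.
Proof. by apply: complexI; rewrite -nrmE normr0. Qed.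

Lemma nrm_eq0 (V : normedZmodType R[i]) (v : V) : nrm v = 0 -> v = 0.
Proof. by move=> v0; apply/normr0_eq0; rewrite nrmE v0. Qed.

Lemma nrm_le_all_eq0 (V : normedZmodType R[i]) (v : V) :
  (forall e : R, 0 < e -> nrm v <= e) -> v = 0.
Proof.
move=> ve; apply/nrm_eq0/eqP; rewrite eq_le nrm_ge0 andbT.
by apply/ler_addgt0Pr => e /ve; rewrite add0r.
Qed.

Lemma nrm_gt0 (V : normedZmodType R[i]) (v : V) : v != 0 -> 0 < nrm v.
Proof.
by move=> v0; rewrite lt_def nrm_ge0 andbT; apply: contra_neq v0 => /nrm_eq0.
Qed.

Lemma nrmN (V : normedZmodType R[i]) (v : V) : nrm (- v) = nrm v.
Proof. by rewrite /nrm normrN. Qed.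

Lemma nrmC (V : normedZmodType R[i]) (v w : V) : nrm (v - w) = nrm (w - v).
Proof. by rewrite /nrm distrC. Qed.

Lemma nrmD (V : normedZmodType R[i]) (v w : V) : nrm (v + w) <= nrm v + nrm w.
Proof. by rewrite -lecR rmorphD /= -!nrmE ler_normD. Qed.

Lemma nrmB (V : normedZmodType R[i]) (v w : V) : nrm (v - w) <= nrm v + nrm w.
Proof. by rewrite -(nrmN w) nrmD. Qed.

Lemma nrm_dist (V : normedZmodType R[i]) (u v w : V) :
  nrm (v - w) <= nrm (v - u) + nrm (u - w).
Proof. by rewrite -(subrKA u) nrmD. Qed.

Lemma nrmM (x y : R[i]) : nrm (x * y) = nrm x * nrm y.
Proof. by apply: complexI; rewrite rmorphM /= -!nrmE normrM. Qed.

Lemma nrmZ (V : normedModType R[i]) (k : R[i]) (v : V) :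
  nrm (k *: v) = nrm k * nrm v.
Proof. by apply: complexI; rewrite rmorphM /= -!nrmE normrZ. Qed.

Lemma nrm_real (r : R) : nrm (r%:C : R[i]) = `|r|.
Proof.
by apply: complexI; rewrite -nrmE normc_def /= expr0n /= addr0 sqrtr_sqr.
Qed.

Lemma nrm1 : nrm (1 : R[i]) = 1.
Proof. by rewrite (nrm_real 1) normr1. Qed.

Lemma nbhs_nrm (V : pseudoMetricNormedZmodType R[i]) (x : V) (U : set V) :
  nbhs x U <-> exists2 e : R, 0 < e & forall y, nrm (y - x) < e -> U y.
Proof.
split=> [/nbhs_ballP[e e0 eU]|[e e0 eU]]; last apply/nbhs_ballP.
- have re : (complex.Re e)%:C = e by rewrite RRe_real // gtr0_real.
  exists (complex.Re e); first by rewrite -ltcR re.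
  move=> y ye; apply: eU; rewrite -ball_normE /= distrC nrmE -re ltcR //.
- exists (e%:C); first by rewrite /= ltcR.
  move=> y; rewrite -ball_normE /= distrC nrmE ltcR; exact: eU.
Qed.

Lemma complete_nrm (V : completeNormedModType R[i]) (u : nat -> V) :
  (forall e : R, 0 < e -> exists N, forall n, (N <= n)%N -> nrm (u n - u N) < e) ->
  exists l, forall e : R, 0 < e ->
    exists N, forall n, (N <= n)%N -> nrm (u n - l) < e.
Proof.
move=> cu; have : cvg (u @ \oo).
  apply: cauchy_cvg; apply: cauchy_exP => e e0.
  have re : (complex.Re e)%:C = e by rewrite RRe_real // gtr0_real.
  have /cu[N uN] : 0 < complex.Re e by rewrite -ltcR re.
  exists (u N), N => // n /= Nn.
  by rewrite -ball_normE /= distrC nrmE -re ltcR uN.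
move/cvg_ex => [l ul]; exists l => e e0.
have : nbhs l [set y | nrm (y - l) < e] by apply/nbhs_nrm; exists e.
by move/ul => [N _ uN]; exists N => n Nn; exact: uN.
Qed.

End RealNorm.

Section ScalarFunctional.
Variables (R : nzRingType) (V : lmodType R) (phi : V -> R).
Hypothesis phi_lin : scalar phi.

Lemma functionalD u v : phi (u + v) = phi u + phi v.
Proof. by have := phi_lin 1 u v; rewrite scale1r mul1r. Qed.

Lemma functionalB u v : phi (u - v) = phi u - phi v.
Proof. by rewrite (addrC u) -scaleN1r phi_lin mulN1r addrC. Qed.

Lemma functional0 : phi 0 = 0.
Proof. by rewrite -(subrr 0) functionalB subrr. Qed.

Lemma functionalZ k v : phi (k *: v) = k * phi v.
Proof. by have := phi_lin k v 0; rewrite functional0 !addr0. Qed.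

End ScalarFunctional.

Lemma exp2V_small (R : realType) (c e : R) : 0 < e ->
  exists N, forall n, (N <= n)%N -> c / 2 ^+ n < e.
Proof.
move=> e0; exists (Num.truncn (`|c| / e)).+1 => n Nn.
rewrite ltr_pdivrMr ?exprn_gt0 // mulrC -ltr_pdivrMr //.
apply: (@le_lt_trans _ _ (`|c| / e)).
  by rewrite ler_pM2r ?invr_gt0 // ler_norm.
apply: (@lt_le_trans _ _ n%:R).
  by apply: (lt_le_trans (truncnS_gt _)); rewrite ler_nat.
by rewrite -natrX ler_nat ltnW // ltn_expl.
Qed.

(** The quantity [nrm (u n - u m) + 2 * c / 2 ^+ n] decreases with [n], so the
    tail of the sequence stays within [2 * c / 2 ^+ m] of [u m]. *)
Lemma geometric_cvg (R : realType) (V : completeNormedModType R[i])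
    (u : nat -> V) (c : R) :
  (forall n, nrm (u n.+1 - u n) <= c / 2 ^+ n) ->
  exists l, forall n, nrm (l - u n) <= 2 * c / 2 ^+ n.
Proof.
move=> uc.
have c0 : 0 <= c.
  by have := le_trans (nrm_ge0 _) (uc 0%N); rewrite expr0 divr1.
have step m k : nrm (u (m + k)%N - u m) + 2 * c / 2 ^+ (m + k) <= 2 * c / 2 ^+ m.
  elim: k => [|k IH]; first by rewrite addn0 subrr nrm0 add0r.
  apply: le_trans IH; rewrite addnS.
  have := nrm_dist (u (m + k)%N) (u (m + k).+1) (u m).
  have := uc (m + k)%N; rewrite exprS invfM.
  move: (_ ^- _) => s; lra.
have bd m n : (m <= n)%N -> nrm (u n - u m) <= 2 * c / 2 ^+ m.
  move=> mn; rewrite -(subnKC mn); apply: le_trans (step m (n - m)%N).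
  by rewrite lerDl divr_ge0 ?mulr_ge0 ?exprn_ge0.
have [e e0|l ul] := @complete_nrm R V u.
  have [N /(_ N (leqnn _)) cN] := exp2V_small (2 * c) e0.
  by exists N => n /bd /le_lt_trans; apply.
exists l => n; apply/ler_addgt0Pr => e /ul [N uN].
have := uN (maxn N n) (leq_maxl _ _).
have := bd n (maxn N n) (leq_maxr _ _).
have := nrm_dist (u (maxn N n)) l (u n); rewrite (nrmC l (u (maxn N n))); lra.
Qed.

Lemma geometric_sum (R : realType) (V : completeNormedModType R[i])
    (a : nat -> V) (c : R) :
  (forall n, nrm (a n) <= c / 2 ^+ n) ->
  exists s, forall n, nrm (s - \sum_(k < n) a k) <= 2 * c / 2 ^+ n.
Proof.
move=> ac; apply: geometric_cvg => n.
by rewrite big_ord_recr /= addrAC subrr add0r.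
Qed.

(** * Zabreiko's lemma, closed graphs and uniform boundedness *)

Section Zabreiko.
Variables (R : realType) (E : completeNormedModType R[i]) (p : E -> R).
Hypothesis pD : forall x y, p (x + y) <= p x + p y.
Hypothesis p_le : forall (k : R[i]) x, p (k *: x) <= nrm k * p x.
(** Countable subadditivity, for the series that are dominated by a geometric one:
    all that the successive approximations of [zabreiko] produce. *)
Hypothesis p_sum : forall (a : nat -> E) s c,
  (forall n, nrm (s - \sum_(k < n) a k) <= c / 2 ^+ n) ->
  (forall n, p (a n) <= c / 2 ^+ n) -> p s <= 2 * c.

Let pZ (k : R[i]) x : p (k *: x) = nrm k * p x.
Proof.
have [->|k0] := eqVneq k 0.
  rewrite scale0r nrm0 mul0r; apply/eqP; rewrite eq_le.
  have := pD 0 0; have := p_le 0 0.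
  rewrite scale0r addr0 nrm0 mul0r => -> /=; lra.
apply/eqP; rewrite eq_le p_le /=; have := p_le k^-1 (k *: x).
rewrite scalerA mulVf // scale1r -(ler_pM2l (nrm_gt0 k0)) mulrA -nrmM mulfV //.
by rewrite nrm1 mul1r.
Qed.

Let adherent (N : R) (x : E) :=
  forall e : R, 0 < e -> exists2 y, p y <= N & nrm (x - y) < e.

(** Baire's argument: the space is the union of the sublevel sets of [p], so the
    closure of one of them contains a ball. Otherwise one builds nested balls, the
    [N]-th of which avoids the set [p <= N], and at their common point [p] would
    exceed every integer. *)
Lemma baire_sublevel : exists (N : nat) x0 (r : R), 0 < r /\
  forall x, nrm (x - x0) < r -> adherent N%:R x.
Proof.
apply: contrapT => nbaire.
(* The new centre moves by at most a quarter of the old radius and the radius is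
   at least halved: the limit of the centres then stays within half of every
   radius, hence inside every ball. *)
have step (s : nat * (E * R)) : exists s' : E * R, 0 < s.2.2 ->
    [/\ 0 < s'.2, s'.2 <= s.2.2 / 2, nrm (s'.1 - s.2.1) <= s.2.2 / 4
      & forall y, p y <= s.1%:R -> s'.2 < nrm (s'.1 - y)].
  case: s => N [x0 r] /=; have [r0|] := ltP 0 r; last by exists (x0, r).
  have : exists x, nrm (x - x0) < r / 4 /\ ~ adherent N%:R x.
    apply: contrapT => nx; apply: nbaire; exists N, x0, (r / 4); split.
      by rewrite divr_gt0.
    by move=> x xr; apply: contrapT => nax; apply: nx; exists x.
  move=> [x [xr]]; rewrite -existsNE => -[e /not_implyP[e0 nad]].
  exists (x, Num.min (r / 2) (e / 2)) => _ /=; split.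
  - by rewrite lt_min !divr_gt0.
  - by rewrite ge_min lexx.
  - exact: ltW.
  move=> y py; rewrite ltNge; apply/negP => xy; apply: nad; exists y => //.
  apply: (le_lt_trans xy); rewrite gt_min; apply/orP; right; lra.
have [f fP] := choice step.
pose s := fix s n := if n is m.+1 then f (m, s m) else (0 : E, 1 : R).
have s0 n : 0 < (s n).2 by elim: n => [|n IH] //=; case: (fP (n, s n)).
have sP n := fP (n, s n) (s0 n).
have s2 n : (s n).2 <= 1 / 2 ^+ n.
  elim: n => [|n IH]; first by rewrite expr0 divr1.
  have [_ + _ _] := sP n; rewrite exprS invfM /= => /le_trans; apply.
  move: IH; lra.
have [n|l sl] := @geometric_cvg R E (fun n => (s n).1) 1.
  have [_ _ + _] := sP n; move=> /le_trans; apply.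
  have := s2 n; have := s0 n; lra.
have nested m k :
    nrm ((s (m + k)%N).1 - (s m).1) + (s (m + k)%N).2 / 2 <= (s m).2 / 2.
  elim: k => [|k IH]; first by rewrite addn0 subrr nrm0 add0r.
  apply: le_trans IH; rewrite addnS.
  have [_ + + _] := sP (m + k)%N.
  have := nrm_dist (s (m + k)%N).1 (s (m + k).+1).1 (s m).1.
  rewrite /=; lra.
have lim m : nrm (l - (s m).1) <= (s m).2 / 2.
  apply/ler_addgt0Pr => e e0.
  have [N /(_ _ (leq_addl m N)) sN] := exp2V_small (2 * 1) e0.
  have := nrm_dist (s (m + N)%N).1 l (s m).1.
  by have := nested m N; have := sl (m + N)%N; have := s0 (m + N)%N; lra.
pose N := (Num.truncn (p l)).+1.
have [_ _ _ /(_ l)] := sP N.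
have pl : p l <= N%:R by rewrite ltW // truncnS_gt.
move=> /(_ pl); rewrite nrmC; have := lim N.+1; have := s0 N.+1.
rewrite /=; lra.
Qed.

(** By convexity and symmetry the ball of [baire_sublevel] can be centred at 0;
    rescaling it, a point of the ball is the sum of a series on which [p]
    decreases geometrically. *)
Lemma zabreiko : exists2 M : R, 0 <= M & forall x, p x <= M * nrm x.
Proof.
have [N [x0 [r [r0 ad]]]] := baire_sublevel.
have ad0 x : nrm x < r -> adherent N%:R x.
  move=> xr e e0.
  have [|y1 p1 y1e] := ad (x0 + x) _ e e0; first by rewrite addrC addKr.
  have [|y2 p2 y2e] := ad (x0 - x) _ e e0; first by rewrite addrC addKr nrmN.
  have half : nrm (2^-1 : R[i]) = 2^-1 :> R.
    have -> : (2^-1 : R[i]) = (2^-1 : R)%:C by rewrite fmorphV rmorph_nat.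
    by rewrite nrm_real ger0_norm.
  exists (2^-1 *: (y1 - y2)).
    rewrite pZ half; have := pD y1 (- y2).
    by rewrite -scaleN1r pZ nrmN nrm1; lra.
  have -> : x - 2^-1 *: (y1 - y2) = 2^-1 *: ((x0 + x - y1) - (x0 - x - y2)).
    have -> : (x0 + x - y1) - (x0 - x - y2) = (x + x) - (y1 - y2).
      rewrite !opprD !opprK !addrA [LHS](ACl (1*4*(2*5)*(3*6))) /=.
      by rewrite subrr add0r -!addrA.
    rewrite [RHS]scalerBr -mulr2n -(scaler_nat 2 x) scalerA mulVf ?pnatr_eq0 //.
    by rewrite scale1r.
  by rewrite nrmZ half; have := nrmB (x0 + x - y1) (x0 - x - y2); lra.
have pos n : 0 < 2 ^+ n :> R by exact: exprn_gt0.
have step (s : nat * E) : exists y, nrm s.2 < r / 2 ^+ s.1 ->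
    p y <= N%:R / 2 ^+ s.1 /\ nrm (s.2 - y) < r / 2 ^+ s.1.+1.
  case: s => n x /=; have [xr|] := ltP (nrm x) (r / 2 ^+ n); last by exists 0.
  pose k : R[i] := (2 ^+ n : R)%:C.
  have rk : nrm k = 2 ^+ n by rewrite nrm_real gtr0_norm.
  have rkV : nrm k^-1 = (2 ^+ n)^-1.
    by rewrite -fmorphV nrm_real gtr0_norm // invr_gt0.
  have k0 : k != 0 by rewrite fmorph_eq0 gt_eqF.
  have [||y py yx] := ad0 (k *: x) _ (r / 2).
  - by rewrite nrmZ rk mulrC -ltr_pdivlMr.
  - by rewrite divr_gt0.
  exists (k^-1 *: y) => _; split.
    by rewrite pZ rkV mulrC ler_pM2r // invr_gt0.
  have -> : x - k^-1 *: y = k^-1 *: (k *: x - y).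
    by rewrite scalerBr scalerA mulVf // scale1r.
  by rewrite nrmZ rkV exprS invfM mulrC mulrA ltr_pM2r // invr_gt0.
have [f fP] := choice step.
have bounded x : nrm x < r -> p x <= 2 * (r + N%:R).
  move=> xr.
  pose u := fix u n := if n is m.+1 then u m - f (m, u m) else x.
  have ur n : nrm (u n) < r / 2 ^+ n.
    elim: n => [|n IH]; first by rewrite expr0 divr1.
    by have [_] := fP (n, u n) IH.
  apply: (@p_sum (fun n => f (n, u n))) => n.
    have -> : x - \sum_(k < n) f (k : nat, u k) = u n.
      elim: n => [|n IH]; first by rewrite big_ord0 subr0.
      by rewrite big_ord_recr /= opprD addrA IH.
    apply: (le_trans (ltW (ur n))).
    by rewrite ler_pM2r ?invr_gt0 // lerDl.
  have [+ _] := fP (n, u n) (ur n); move=> /le_trans; apply.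
  by rewrite ler_pM2r ?invr_gt0 // lerDr ltW.
exists (4 * (r + N%:R) / r).
  by rewrite divr_ge0 ?mulr_ge0 ?addr_ge0 // ltW.
move=> x; have [->|x0'] := eqVneq x 0.
  by rewrite -(scale0r (x : E)) nrmZ pZ !nrm0 !mul0r mulr0.
have xp := nrm_gt0 x0'.
pose k : R[i] := (r / 2 / nrm x)%:C.
have kp : 0 < r / 2 / nrm x by rewrite !divr_gt0.
have rk : nrm k = r / 2 / nrm x by rewrite nrm_real gtr0_norm.
have := bounded (k *: x); rewrite nrmZ pZ rk divfK ?gt_eqF //.
have rr : r / 2 < r by lra.
move=> /(_ rr); rewrite mulrC -ler_pdivlMr // => /le_trans; apply.
rewrite le_eqVlt; apply/orP; left; apply/eqP; field.
by rewrite !gt_eqF.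
Qed.

End Zabreiko.

(** [x |-> nrm (L x)] is countably subadditive when the graph of [L] is closed:
    if the images of the terms are summable, their sum is the image of the sum. *)
Lemma closed_graph_bounded (R : realType) (E F : completeNormedModType R[i])
    (L : {linear E -> F}) :
  (forall (u : nat -> E) x y (c : R), (forall n, nrm (x - u n) <= c / 2 ^+ n) ->
    (forall n, nrm (y - L (u n)) <= c / 2 ^+ n) -> L x = y) ->
  exists2 M : R, 0 <= M & forall x, nrm (L x) <= M * nrm x.
Proof.
move=> closedL.
apply: (@zabreiko R E (fun x => nrm (L x))).
- by move=> x y; rewrite linearD nrmD.
- by move=> k x; rewrite linearZ nrmZ.
move=> a s c sa aL.
have c0 : 0 <= c by have := le_trans (nrm_ge0 _) (aL 0%N); rewrite expr0 divr1.
have [y yL] := geometric_sum aL.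
rewrite (closedL (fun n => \sum_(k < n) a k) s y (2 * c)).
- by have := yL 0%N; rewrite big_ord0 subr0 expr0 divr1.
- move=> n; apply: (le_trans (sa n)); rewrite ler_pM2r ?invr_gt0 ?exprn_gt0 //.
  lra.
- by move=> n; rewrite linear_sum.
Qed.

(** The supremum of a pointwise bounded family of bounded functionals is a
    countably subadditive seminorm. *)
Lemma uniform_boundedness (R : realType) (E : completeNormedModType R[i])
    (I : Type) (phi : I -> E -> R[i]) :
  (forall i, scalar (phi i)) ->
  (forall i, exists M : R, forall x, nrm (phi i x) <= M * nrm x) ->
  (forall x, exists M : R, forall i, nrm (phi i x) <= M) ->
  exists M : R, forall i x, nrm (phi i x) <= M * nrm x.
Proof.
move=> phi_lin phi_bd pt_bd.
have [[i0]|noI] := pselect (inhabited I); last first.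
  by exists 0 => i; exfalso; apply: noI.
pose S x := [set nrm (phi i x) | i in [set: I]].
have S0 x : S x !=set0 by exists (nrm (phi i0 x)), i0.
have Sub x : has_ubound (S x).
  by have [M MP] := pt_bd x; exists M => _ [i _ <-].
have le_S i x : nrm (phi i x) <= sup (S x).
  by apply: ub_le_sup => //; exists i.
have [||| M _ MP] := @zabreiko R E (fun x => sup (S x)).
- move=> x y; apply: ge_sup => // _ [i _ <-].
  have -> : phi i (x + y) = phi i x + phi i y.
    exact: functionalD.
  by apply: (le_trans (nrmD _ _)); rewrite lerD.
- move=> k x; apply: ge_sup => // _ [i _ <-].
  by rewrite functionalZ // nrmM ler_wpM2l ?nrm_ge0.
- move=> a s c sa aS; apply: ge_sup => // _ [i _ <-].
  have [M MP] := phi_bd i; apply/ler_addgt0Pr => e e0.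
  have [N /(_ N (leqnn _)) Ne] := exp2V_small (`|M| * c) e0.
  have : nrm (phi i (\sum_(k < N) a k)) + 2 * c / 2 ^+ N <= 2 * c.
    elim: {Ne} N => [|N IH].
      by rewrite big_ord0 functional0 // nrm0 add0r expr0 divr1.
    rewrite big_ord_recr /= functionalD // exprS invfM.
    have := nrmD (phi i (\sum_(k < N) a k)) (phi i (a N)).
    have := le_trans (le_S i _) (aS N); move: IH; move: (2 ^- N) => w; lra.
  have := MP (s - \sum_(k < N) a k); rewrite functionalB //.
  have := nrmD (phi i s - phi i (\sum_(k < N) a k)) (phi i (\sum_(k < N) a k)).
  rewrite subrK.
  have := ler_wpM2l (normr_ge0 M) (sa N).
  have := ler_wpM2r (nrm_ge0 (s - \sum_(k < N) a k)) (ler_norm M).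
  have c0 : 0 <= 2 * c / 2 ^+ N.
    have := le_trans (nrm_ge0 _) (sa N); lra.
  move: c0 Ne; rewrite mulrA; lra.
by exists M => i x; apply: (le_trans (le_S i x)).
Qed.


(** * Characters and the Gelfand topology *)

Lemma nrm_ReIm (R : realType) (z : R[i]) :
  [/\ `|complex.Re z| <= nrm z, `|complex.Im z| <= nrm z
    & nrm z <= `|complex.Re z| + `|complex.Im z|].
Proof.
rewrite /nrm normc_def /=; case: z => a b /=; split.
- by rewrite -sqrtr_sqr ler_wsqrtr // lerDl sqr_ge0.
- by rewrite -sqrtr_sqr ler_wsqrtr // lerDr sqr_ge0.
- rewrite -[leRHS]ger0_norm ?addr_ge0 // -sqrtr_sqr ler_wsqrtr //.
  by rewrite sqrrD !real_normK ?num_real // addrAC lerDl mulrn_wge0 // mulr_ge0.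
Qed.

Lemma complex_square_compact (R : realType) (r : R) :
  compact [set z : Cplx R | `|complex.Re z| <= r /\ `|complex.Im z| <= r].
Proof.
pose f (p : R * R) : Cplx R := p.1 +i* p.2.
have -> : [set z : Cplx R | `|complex.Re z| <= r /\ `|complex.Im z| <= r] =
    f @` (`[- r, r] `*` `[- r, r]).
  apply/seteqP; split=> [[a b] /= [ar br]|_ [[a b] /= [+ +] <-]].
    by exists (a, b) => //=; rewrite !in_itv /= -!ler_norml.
  by rewrite /= !in_itv /= -!ler_norml.
apply: continuous_compact; last first.
  by apply: compact_setX; exact: segment_compact.
apply: continuous_subspaceT => -[a b] U /nbhs_nrm[e e0 eU].
have e2 : 0 < e / 2 by rewrite divr_gt0.
exists (ball a (e / 2), ball b (e / 2)).
  by split; exact: nbhsx_ballx.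
move=> [a' b'] [/=]; rewrite -!ball_normE /= => aa bb; apply: eU.
have [_ _ /=] := nrm_ReIm (f (a', b') - f (a, b)).
rewrite distrC in aa; rewrite distrC in bb; move=> /le_lt_trans; apply.
by rewrite [ltRHS]splitr ltrD.
Qed.

Section Algebra.
Variables (R : realType) (A : commBanachAlgType R).
Implicit Types (a b c : A) (x y : char_space A).

Lemma bmulDr a b c : bmul a (b + c) = bmul a b + bmul a c.
Proof. by rewrite bmulC bmulDl !(bmulC a). Qed.

Lemma bmul0l a : bmul 0 a = 0.
Proof. by apply: (addrI (bmul 0 a)); rewrite -bmulDl !addr0. Qed.

Lemma bmul0r a : bmul a 0 = 0.
Proof. by rewrite bmulC bmul0l. Qed.

Lemma bmulNl a b : bmul (- a) b = - bmul a b.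
Proof. by apply: (addrI (bmul a b)); rewrite -bmulDl !subrr bmul0l. Qed.

Lemma bmulBr a b c : bmul a (b - c) = bmul a b - bmul a c.
Proof. by rewrite bmulDr (bmulC a (- c)) bmulNl (bmulC a c). Qed.

Lemma nrm_bmul a b : nrm (bmul a b) <= nrm a * nrm b.
Proof. by rewrite -lecR rmorphM /= -!nrmE bmul_norm. Qed.

Lemma gelfandD a b x : gelfand (a + b) x = gelfand a x + gelfand b x.
Proof.
by have [xl _ _] := set_mem (valP x); have := xl 1 a b; rewrite scale1r mul1r.
Qed.

Lemma gelfand0 x : gelfand (0 : A) x = 0.
Proof. by apply: (addrI (gelfand (0 : A) x)); rewrite -gelfandD !addr0. Qed.

Lemma gelfandZ (k : R[i]) a x : gelfand (k *: a) x = k * gelfand a x.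
Proof.
have [xl _ _] := set_mem (valP x).
have : gelfand (k *: a + 0) x = k * gelfand a x + gelfand 0 x := xl k a 0.
by rewrite gelfand0 !addr0.
Qed.

Lemma gelfandN a x : gelfand (- a) x = - gelfand a x.
Proof. by rewrite -scaleN1r gelfandZ mulN1r. Qed.

Lemma gelfandB a b x : gelfand (a - b) x = gelfand a x - gelfand b x.
Proof. by rewrite gelfandD gelfandN. Qed.

Lemma gelfandM a b x : gelfand (bmul a b) x = gelfand a x * gelfand b x.
Proof. by have [_ xm _] := set_mem (valP x); exact: xm. Qed.

Lemma gelfand_eq1 x : exists a, gelfand a x = 1.
Proof.
have [_ _ [a a0]] := set_mem (valP x); exists ((gelfand a x)^-1 *: a).
by rewrite gelfandZ mulVf.
Qed.

Lemma char_space_neq x y : x != y -> exists a, gelfand a x != gelfand a y.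
Proof.
move=> xy; apply: contrapT => /forallNP nxy; move/eqP: xy; apply.
apply: val_inj; apply: funext => a; apply/eqP/negPn/negP; exact: nxy.
Qed.

(** [s] is the sum of the powers of [a]: formally, [1 + s] inverts [1 - a]. *)
Lemma quasi_inverse a : nrm a <= 2^-1 -> exists s, s = a + bmul a s.
Proof.
move=> a2; pose pw n := iter n (bmul a) a.
have pwn n : nrm (pw n) <= 2^-1 / 2 ^+ n.
  elim: n => [|n IH]; first by rewrite expr0 divr1.
  apply: (le_trans (nrm_bmul _ _)); rewrite exprS invfM.
  by apply: ler_pM => //; exact: nrm_ge0.
have [s sS] := geometric_sum pwn; exists s; apply/eqP; rewrite -subr_eq0.
apply/eqP/nrm_le_all_eq0 => e e0.
have [N /(_ N (leqnn _)) Ne] := exp2V_small 2 e0.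
have Srec : \sum_(k < N.+1) pw k = a + bmul a (\sum_(k < N) pw k).
  rewrite big_ord_recl /=; congr (_ + _).
  elim: {e e0 Ne} N => [|N IH]; first by rewrite !big_ord0 bmul0r.
  by rewrite !big_ord_recr /= IH bmulDr.
have -> : s - (a + bmul a s) =
    (s - \sum_(k < N.+1) pw k) - bmul a (s - \sum_(k < N) pw k).
  by rewrite Srec bmulBr !opprD !opprK !addrA [RHS]addrAC subrK.
have := nrmB (s - \sum_(k < N.+1) pw k) (bmul a (s - \sum_(k < N) pw k)).
have := nrm_bmul a (s - \sum_(k < N) pw k).
have := ler_wpM2r (nrm_ge0 (s - \sum_(k < N) pw k)) a2.
have := sS N; have := sS N.+1; rewrite exprS invfM.
move: Ne; move: (2 ^- N) (nrm_ge0 a) => w; lra.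
Qed.

(** If [x] sends [a] to 1 and [nrm a] is at most 1/2, a quasi-inverse [s] of [a]
    satisfies [gelfand s x = 1 + gelfand s x]. The constant 2 leaves
    room to sum only geometric series of ratio 1/2. *)
Lemma gelfand_le a x : nrm (gelfand a x) <= 2 * nrm a.
Proof.
rewrite leNgt; apply/negP => ax.
have x0 : 0 < nrm (gelfand a x) by have := nrm_ge0 a; lra.
have g0 : gelfand a x != 0 by apply/eqP => g0; rewrite g0 nrm0 ltxx in x0.
have [|s se] := @quasi_inverse ((gelfand a x)^-1 *: a).
  rewrite nrmZ -(ler_pM2l x0) mulrA -nrmM divff // nrm1 mul1r; lra.
have := congr1 (fun c => gelfand c x) se.
rewrite gelfandD gelfandM gelfandZ mulVf // mul1r -[X in X = _]add0r => /addIr /eqP.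
by rewrite eq_sym oner_eq0.
Qed.

Lemma gelfand_continuous a : continuous (gelfand a).
Proof.
move=> x; apply: (@continuous_comp _ _ _ set_val
  (fun f : prod_topology (fun _ : A => Cplx R) => f a)).
  exact: initial_continuous.
exact: (@proj_continuous A (fun=> Cplx R) a).
Qed.

Lemma gelfand_near a x (e : R) : 0 < e ->
  nbhs x [set z | nrm (gelfand a z - gelfand a x) < e].
Proof.
move=> e0; apply: (@gelfand_continuous a x [set w | nrm (w - gelfand a x) < e]).
by apply/nbhs_nrm; exists e.
Qed.

Lemma open_gelfand_gt a (e : R) : open [set z | e < nrm (gelfand a z)].
Proof.
rewrite openE => x /= ex.
have : 0 < nrm (gelfand a x) - e by rewrite subr_gt0.
move=> /(gelfand_near a x); apply: filterS => z /=.
have := nrmD (gelfand a z) (gelfand a x - gelfand a z).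
by rewrite addrC subrK nrmC; lra.
Qed.

Lemma open_coz a : open (coz (gelfand a)).
Proof.
rewrite (_ : coz _ = [set z | 0 < nrm (gelfand a z)]); first exact: open_gelfand_gt.
apply/seteqP; split=> x /=; first exact: nrm_gt0.
by apply: contraTneq => ->; rewrite nrm0 ltxx.
Qed.

Lemma char_space_separated x y : x != y -> exists U V : set (char_space A),
  [/\ open U, open V, U x, V y & U `&` V = set0].
Proof.
move=> /char_space_neq[a axy].
have d0 : 0 < nrm (gelfand a x - gelfand a y) / 2.
  by rewrite divr_gt0 // nrm_gt0 // subr_eq0.
have := gelfand_near a x d0; rewrite nbhsE => -[U [oU Ux] Ua].
have := gelfand_near a y d0; rewrite nbhsE => -[V [oV Vy] Va].
exists U, V; split=> //; rewrite -subset0 => z [/Ua /= + /Va /=].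
have := nrm_dist (gelfand a z) (gelfand a x) (gelfand a y).
rewrite (nrmC (gelfand a x) (gelfand a z)); lra.
Qed.

Lemma char_space_hausdorff : hausdorff_space (char_space A).
Proof.
rewrite open_hausdorff => x y /char_space_separated[U [V [oU oV Ux Vy UV]]].
by exists (U, V); rewrite ?inE //=; split=> //; apply/eqP.
Qed.

(** A set of this form, seen among all functions on [A], is closed in the product
    of the discs of radius [2 * nrm b]: limits of characters are multiplicative
    functionals, and they are nonzero because the value at [a] stays at least
    [e]. This gives local compactness and the vanishing of transforms at
    infinity. *)
Lemma gelfand_ge_compact a (e : R) : 0 < e ->
  compact [set z | e <= nrm (gelfand a z)].
Proof.
move=> e0; pose P := prod_topology (fun _ : A => Cplx R).
pose K : set P := characters (A := A) `&` [set f | e <= nrm (f a)].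
pose D : set P := [set f | forall b,
  `|complex.Re (f b)| <= 2 * nrm b /\ `|complex.Im (f b)| <= 2 * nrm b].
have cD : compact D.
  apply: (@tychonoff A (fun=> Cplx R) (fun b => [set z : Cplx R |
    `|complex.Re z| <= 2 * nrm b /\ `|complex.Im z| <= 2 * nrm b])) => b.
  exact: complex_square_compact.
have KD : K `<=` D.
  move=> f [fc _] b; have := gelfand_le b (SigSub (mem_set fc)).
  rewrite /gelfand /= => fb; have [re im _] := nrm_ReIm (f b).
  by split; [exact: le_trans re fb|exact: le_trans im fb].
have near_at (f : P) b (d : R) : 0 < d -> nbhs f [set g : P | nrm (g b - f b) < d].
  move=> d0.
  apply: (@proj_continuous A (fun=> Cplx R) b f [set w | nrm (w - f b) < d]).
  by apply/nbhs_nrm; exists d.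
have cK : closed K.
  move=> f fK.
  have approx b1 b2 b3 (d : R) : 0 < d -> exists g : P, [/\ K g,
      nrm (g b1 - f b1) < d, nrm (g b2 - f b2) < d & nrm (g b3 - f b3) < d].
    move=> d0; have [g [Kg [[g1 g2] g3]]] := fK _ (filterI (filterI
      (near_at f b1 d d0) (near_at f b2 d d0)) (near_at f b3 d d0)).
    by exists g.
  have fa : e <= nrm (f a).
    apply/ler_addgt0Pr => d /(approx a a a)[g [[_ /= ga] fg _ _]].
    have := nrmD (f a) (g a - f a); rewrite addrC subrK; lra.
  split=> //; split.
  - move=> k b1 b2; apply/eqP; rewrite -subr_eq0; apply/eqP/nrm_le_all_eq0 => d d0.
    have k0 : 0 < 2 + nrm k by have := nrm_ge0 k; lra.
    have [d1 d' ->] : exists2 d1, 0 < d1 & d = (2 + nrm k) * d1.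
      by exists (d / (2 + nrm k)); rewrite ?divr_gt0 // mulrC divfK // gt_eqF.
    have [g [[[gl _ _] _] g1 g2 g3]] := approx b1 b2 (k *: b1 + b2) _ d'.
    have -> : f (k *: b1 + b2) - (k * f b1 + f b2) =
      - (g (k *: b1 + b2) - f (k *: b1 + b2)) + (k * (g b1 - f b1) + (g b2 - f b2)).
      by rewrite gl; ring.
    apply: (le_trans (nrmD _ _)); rewrite nrmN.
    have := nrmD (k * (g b1 - f b1)) (g b2 - f b2); rewrite nrmM.
    have := ler_wpM2l (nrm_ge0 k) (ltW g1); lra.
  - move=> b1 b2; apply/eqP; rewrite -subr_eq0; apply/eqP/nrm_le_all_eq0 => d d0.
    pose M := 1 + nrm (f b1) + (2 * nrm b2).
    have M0 : 0 < M.
      by rewrite /M; have := nrm_ge0 (f b1); have := nrm_ge0 b2; lra.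
    have [d1 d' ->] : exists2 d1, 0 < d1 & d = M * d1.
      by exists (d / M); rewrite ?divr_gt0 // mulrC divfK // gt_eqF.
    have [g [Kg g1 g2 g3]] := approx b1 b2 (bmul b1 b2) _ d'.
    have [gc _] := Kg.
    have gm : forall b c, g (bmul b c) = g b * g c by case: gc.
    have := gelfand_le b2 (SigSub (mem_set gc)); rewrite /gelfand /= => gb2.
    have -> : f (bmul b1 b2) - f b1 * f b2 =
      - (g (bmul b1 b2) - f (bmul b1 b2)) +
        ((g b1 - f b1) * g b2 + f b1 * (g b2 - f b2)).
      by rewrite gm; ring.
    apply: (le_trans (nrmD _ _)); rewrite nrmN.
    have := nrmD ((g b1 - f b1) * g b2) (f b1 * (g b2 - f b2)); rewrite !nrmM.
    have := ler_wpM2l (nrm_ge0 (f b1)) (ltW g2).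
    have := ler_pM (nrm_ge0 _) (nrm_ge0 _) (ltW g1) gb2; rewrite /M; lra.
  - exists a; apply/eqP => fa0; rewrite fa0 nrm0 in fa; lra.
have {cK}cK : compact K by exact: subclosed_compact cK cD KD.
move=> F FF Fe; have FK : F (set_val @^-1` K).
  by apply: filterS Fe => x /= xe; split=> //; exact: set_mem (valP x).
have [f [[fc fe] fcl]] := cK (set_val @ F) _ FK.
exists (SigSub (mem_set fc)); split => //.
move=> U V FU [_ [[W oW <-] Wf WV]].
have nW : nbhs (f : P) W by exact: open_nbhs_nbhs.
have FU' : (set_val @ F) (set_val @` U).
  have UU : U `<=` set_val @^-1` (set_val @` U) by move=> z Uz; exists z.
  exact: filterS UU FU.
have [_ [[z Uz <-] Wz]] := fcl _ _ FU' nW.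
by exists z; split=> //; exact: WV.
Qed.

End Algebra.


(** * Local units and the one-point compactification *)

Lemma compact_finite_cover (X : topologicalType) (K : set X) (W : X -> set X) :
  compact K -> (forall x, nbhs x (W x)) ->
  exists s : seq X, forall z, K z -> exists2 x, x \in s & W x z.
Proof.
move=> /compact_near_coveringP cK nW.
pose F := filter_from [set: seq X] (fun s => [set s' : seq X | {subset s <= s'}]).
have FF : Filter F.
  apply: filter_from_filter; first by exists [::].
  move=> s1 s2 _ _; exists (s1 ++ s2) => // s' sub.
  by split=> x xs; apply: sub; rewrite mem_cat xs ?orbT.
have [x _|s _ sP] := cK _ F (fun s z => exists2 x, x \in s & W x z) FF.
  exists (W x, [set s : seq X | x \in s]) => /=.
    split; first exact: nW.
    by exists [:: x] => // s' sub; apply: sub; rewrite mem_head.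
  by move=> [z s] [/= Wz xs]; exists x.
by exists s => z Kz; apply: (sP s).
Qed.

Section Localisation.
Variables (R : realType) (A : commBanachAlgType R).
Implicit Types (a b c : A) (x y : char_space A).
Local Notation opcA := (one_point_compactification (char_space A)).

Lemma opc_open_compl (K : set (char_space A)) :
  compact K -> open (~` (Some @` K) : set opcA).
Proof.
move=> cK; have clK : closed K := compact_closed (@char_space_hausdorff R A) cK.
rewrite openE => -[x|] nK.
  have nx : nbhs x (~` K).
    apply: open_nbhs_nbhs; split; first exact: closed_openC.
    by move=> Kx; apply: nK; exists x.
  by apply: filterS nx => z nz [w Kw [wz]]; apply: nz; rewrite -wz.
by exists K => //= -[z|] [] // [w nw [<-]] [v Kv [vw]]; apply: nw; rewrite -vw.
Qed.

Lemma compact_nbhs x : exists2 K : set (char_space A), nbhs x K & compact K.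
Proof.
have [a ax] := gelfand_eq1 x.
exists [set z | 2^-1 <= nrm (gelfand a z)]; last by apply: gelfand_ge_compact.
have : nbhs x [set z | 2^-1 < nrm (gelfand a z)].
  apply: open_nbhs_nbhs; split; first exact: open_gelfand_gt.
  by rewrite /= ax nrm1; lra.
by apply: filterS => z /= /ltW.
Qed.

(** A character is separated from the point at infinity by a compact
    neighbourhood. *)
Lemma opc_separated (p q : opcA) : p != q -> exists U V : set opcA,
  [/\ open U, open V, U p, V q & U `&` V = set0].
Proof.
have inf x : exists U V : set opcA,
    [/\ open U, open V, U (Some x), V None & U `&` V = set0].
  have [K nK cK] := compact_nbhs x.
  move: nK; rewrite nbhsE => -[O [oO Ox] OK].
  exists (Some @` O), (~` (Some @` K)); split.
  - exact: one_point_compactification_open_some.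
  - exact: opc_open_compl.
  - by exists x.
  - by case.
  - by rewrite -subset0 => z [[w /OK Kw <-]]; apply; exists w.
case: p q => [x|] [y|] //.
- move=> xy; have [|U [V [oU oV Ux Vy UV]]] := @char_space_separated R A x y.
    by apply: contra_neq xy => ->.
  exists (Some @` U), (Some @` V); split.
  + exact: one_point_compactification_open_some.
  + exact: one_point_compactification_open_some.
  + by exists x.
  + by exists y.
  rewrite -subset0 => z [[w Uw <-] [v Vv [vw]]].
  have : (U `&` V) w by split=> //; rewrite -vw.
  by rewrite UV.
- by move=> _; have [U [V [? ? ? ? UV]]] := inf y; exists V, U; rewrite setIC.
Qed.

Lemma opc_open_Some (V : set opcA) x : open V -> V (Some x) ->
  nbhs x [set z | V (Some z)].
Proof. by rewrite openE => oV /oV. Qed.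

Lemma opc_open_None (V : set opcA) : open V -> V None ->
  exists2 K : set (char_space A), compact K & forall z, ~ K z -> V (Some z).
Proof.
rewrite openE => oV /oV [K [cK _] KV].
by exists K => // z nz; apply: KV; left; exists z.
Qed.

Hypothesis MA : condition_M A.

Lemma condition_M_multiplier x a (U : set (char_space A)) (e : R) :
  gelfand a x = 0 -> nbhs x U -> 0 < e ->
  exists b, [/\ exists2 V, nbhs x V & forall z, V z -> gelfand b z = 1,
    supp (gelfand b) `<=` U & nrm (bmul b a) < e].
Proof.
move=> a0 nU e0; case: MA => _ /(_ x a U a0 nU) inf0.
have [|_ [b [bV bU] <-]] := @ereal_inf_lt _ [set (rnorm (bmul b a))%:E | b in
      [set b : A | (exists2 V, nbhs x V & forall z, V z -> gelfand b z = 1)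
                   /\ supp (gelfand b) `<=` U]] (e%:E).
  by rewrite inf0 lte_fin.
by rewrite lte_fin => be; exists b.
Qed.

(** The infimum of condition (M) for [a = 0] is 0 and not infinite, so the set
    over which it is taken is inhabited. *)
Lemma local_unit x (U : set (char_space A)) : nbhs x U ->
  exists b V, [/\ open V, V x, forall z, V z -> gelfand b z = 1,
    supp (gelfand b) `<=` U & compact (supp (gelfand b))].
Proof.
move=> nU; have [K nK cK] := compact_nbhs x.
have [b [[V nV bV] bU _]] :=
  condition_M_multiplier (gelfand0 x) (filterI nU nK) (ltr01 : 0 < 1 :> R).
move: nV; rewrite nbhsE => -[W [oW Wx] WV].
exists b, W; split=> //.
- by move=> z /WV /bV.
- by move=> z /bU [].
by apply: subclosed_compact cK _; [exact: closed_closure|move=> z /bU []].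
Qed.

Hypothesis ssA : semisimple A.

(** * Functionals and their supports *)

Section Functional.
Variable phi : A -> R[i].
Hypothesis phi_lin : scalar phi.

(** Being annihilated by a functional is a local property on the compactification.
    Outside a compact [K] the neighbourhood of infinity takes over; on [K],
    finitely many local units [b x] cover, and passing from [c] to
    [c - bmul (b x) c] changes neither [phi c] nor the containment of supports,
    while it kills the transform near [x]. *)
Lemma functional_local a :
  (forall p : opcA, exists V : set opcA, [/\ open V, V p & forall c,
    coz (gelfand c) `<=` coz (gelfand a) ->
    [set Some x | x in coz (gelfand c)] `<=` V -> phi c = 0]) ->
  phi a = 0.
Proof.
move=> loc; have /choice[V VP] := loc.
have [oV Vp _] := VP None; have [K cK KV] := opc_open_None oV Vp.
have /choice[b /choice[W bW]] : forall x, exists b W, [/\ open W, W x,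
    forall z, W z -> gelfand b z = 1
  & forall z, coz (gelfand b) z -> V (Some x) (Some z)].
  move=> x; have [oVx Vx _] := VP (Some x).
  have [b [W [oW Wx b1 bV _]]] := local_unit (opc_open_Some oVx Vx).
  by exists b, W; split=> // z bz; apply: bV; exact: subset_closure.
have [|s sK] := compact_finite_cover (W := W) cK.
  by move=> x; apply: open_nbhs_nbhs; have [] := bW x.
pose d := foldr (fun x c => c - bmul (b x) c) a s.
have [dphi da ds] : [/\ phi d = phi a, coz (gelfand d) `<=` coz (gelfand a)
    & forall x z, x \in s -> W x z -> gelfand d z = 0].
  rewrite {}/d; elim: s {sK} => [|x s] /=.
    by split=> // x z; rewrite in_nil.
  move: (foldr _ _ _) => d [IHp IHc IH0]; split.
  - rewrite (functionalB phi_lin) IHp.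
    have [_ _ /(_ (bmul (b x) d)) ->] := VP (Some x).
    + by rewrite subr0.
    + move=> z; rewrite /coz /= gelfandM mulf_eq0 negb_or => /andP[_].
      exact: IHc.
    + move=> _ [z + <-]; rewrite /coz /= gelfandM mulf_eq0 negb_or.
      move=> /andP[bz _].
      by have [_ _ _] := bW x; apply.
  - move=> z dz; apply: IHc; move: dz; rewrite /coz /= gelfandB gelfandM.
    by apply: contra_neq => ->; rewrite mulr0 subrr.
  - move=> x' z; rewrite inE gelfandB gelfandM => /orP[/eqP ->|x's] Wz.
      by have [_ _ -> // _] := bW x; rewrite mul1r subrr.
    by rewrite (IH0 x') // mulr0 subrr.
rewrite -dphi; have [_ _] := VP None; apply => // _ [z dz <-].
apply: KV => /sK [x xs Wz]; move: dz; rewrite /coz /= (ds x) //.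
by rewrite eqxx.
Qed.

Lemma functional_supp_nonempty : (exists a, phi a != 0) ->
  exists p, functional_supp (phi : A -> Cplx R) p.
Proof.
move=> [a a0]; apply: contrapT => /forallNP np; move/eqP: a0; apply.
apply: functional_local => p; have := np p.
by move=> /contrapT [V [oV Vv] Vp]; exists V; split=> // c _ /Vv.
Qed.

(** Two points of the support have disjoint neighbourhoods, each carrying an
    element that is not annihilated; the product of these two elements is 0. *)
Lemma functional_supp_atmost :
  (forall a b, bmul a b = 0 -> phi a = 0 \/ phi b = 0) ->
  forall p q, functional_supp (phi : A -> Cplx R) p ->
  functional_supp (phi : A -> Cplx R) q -> p = q.
Proof.
move=> sep p q pS qS; apply/eqP/negPn/negP => /opc_separated.
move=> [U [V [oU oV Up Vq UV]]].
have nonvan (O : set opcA) r : open O -> O r ->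
    functional_supp (phi : A -> Cplx R) r ->
    exists2 a, [set Some x | x in coz (gelfand a)] `<=` O & phi a <> 0.
  move=> oO Or rS; apply: contrapT => na; apply: rS; exists O => //.
  by split=> // a aO; apply: contrapT => a0; apply: na; exists a.
have [a aU a0] := nonvan U p oU Up pS.
have [b bV b0] := nonvan V q oV Vq qS.
have : bmul a b = 0.
  apply: ssA => x; rewrite gelfandM; apply/eqP; rewrite mulf_eq0.
  apply: contrapT => /negP; rewrite negb_or => /andP[ax bx].
  suff : (U `&` V) (Some x) by rewrite UV.
  by split; [apply: aU; exists x|apply: bV; exists x].
by move=> /sep [].
Qed.

Variable p : opcA.
Hypothesis supp_p : functional_supp (phi : A -> Cplx R) = [set p].

Lemma functional_away a (N : set opcA) : open N -> N p ->
  (forall x, N (Some x) -> gelfand a x = 0) -> phi a = 0.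
Proof.
move=> oN Np aN; apply: functional_local => q.
have [->|qp] := eqVneq q p.
  exists N; split=> // c ca cN; rewrite (_ : c = 0) ?functional0 //; apply: ssA => x.
  apply/eqP/negPn/negP => cx; have /eqP := ca _ cx; apply.
  by apply: aN; apply: cN; exists x.
have : ~ functional_supp (phi : A -> Cplx R) q.
  by rewrite supp_p => /eqP; apply/negP.
by move=> /contrapT [V [oV Vv] Vq]; exists V; split=> // c _ /Vv.
Qed.

Lemma functional_eq_near a b (N : set opcA) : open N -> N p ->
  (forall x, N (Some x) -> gelfand a x = gelfand b x) -> phi a = phi b.
Proof.
move=> oN Np ab; apply/eqP; rewrite -subr_eq0 -(functionalB phi_lin); apply/eqP.
by apply: functional_away oN Np _ => x /ab; rewrite gelfandB => ->; rewrite subrr.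
Qed.

Lemma functional_compact_away a : compact (supp (gelfand a)) ->
  (forall x, p = Some x -> ~ supp (gelfand a) x) -> phi a = 0.
Proof.
move=> ca pa; apply: functional_away (opc_open_compl ca) _ _.
  by move=> [x ax xp]; exact: (pa x).
move=> x nx; apply/eqP/negPn/negP => ax; apply: nx; exists x => //.
exact: subset_closure.
Qed.

End Functional.

Section PointSupport.
Variables (phi : A -> R[i]) (x : char_space A).
Hypothesis phi_lin : scalar phi.
Hypothesis supp_x : functional_supp (phi : A -> Cplx R) = [set Some x].

Lemma functional_eq_nbhs a b (V : set (char_space A)) : nbhs x V ->
  (forall z, V z -> gelfand a z = gelfand b z) -> phi a = phi b.
Proof.
rewrite nbhsE => -[O [oO Ox] OV] ab.
apply: (functional_eq_near phi_lin supp_x (N := Some @` O)).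
- exact: one_point_compactification_open_some.
- by exists x.
- by move=> z [w Ow [<-]]; apply/ab/OV.
Qed.

(** The step where condition (M) is used in full: if [gelfand c x = 0] then
    [phi c = phi (bmul b c)] for every [b] equal to 1 near [x], and [bmul b c] can
    be made as small as one likes. *)
Lemma functional_bounded_eval (M : R) e a :
  (forall c, nrm (phi c) <= M * nrm c) -> gelfand e x = 1 ->
  phi a = phi e * gelfand a x.
Proof.
move=> phiM ex.
have phi_ker c : gelfand c x = 0 -> phi c = 0.
  move=> cx; apply: nrm_le_all_eq0 => d d0.
  have M0 : 0 < `|M| + 1 by rewrite ltr_wpDl.
  have [b [[V nV bV] _ bc]] :=
    condition_M_multiplier cx filterT (divr_gt0 d0 M0).
  have -> : phi c = phi (bmul b c).
    apply: functional_eq_nbhs nV _ => z /bV.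
    by rewrite gelfandM => ->; rewrite mul1r.
  apply: (le_trans (phiM _)).
  move: bc; rewrite ltr_pdivlMr // => /ltW; apply: le_trans.
  rewrite mulrC ler_wpM2l ?nrm_ge0 //; have := ler_norm M; lra.
have := phi_ker (a - gelfand a x *: e).
rewrite gelfandB gelfandZ ex mulr1 subrr => /(_ erefl).
rewrite (functionalB phi_lin) (functionalZ phi_lin) mulrC => /eqP.
by rewrite subr_eq0 => /eqP.
Qed.

(** At an isolated point the germ of a transform is its value, so [phi] is already
    a multiple of evaluation. *)
Lemma functional_bounded_isolated : open [set x] ->
  exists M : R, forall a, nrm (phi a) <= M * nrm a.
Proof.
move=> ox; have [e ex] := gelfand_eq1 x; exists (2 * nrm (phi e)) => a.
have -> : phi a = phi (gelfand a x *: e).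
  apply: (@functional_eq_nbhs _ _ [set x]); first exact: open_nbhs_nbhs.
  by move=> _ ->; rewrite gelfandZ ex mulr1.
rewrite (functionalZ phi_lin) nrmM mulrC mulrAC [leRHS]mulrC.
by rewrite ler_wpM2l ?nrm_ge0 // gelfand_le.
Qed.

(** Multiplying by a local unit moves an element on which an unbounded functional
    is large into any neighbourhood of the support. *)
Lemma functional_unbounded_local (U : set (char_space A)) (e n : R) :
  ~ (exists M : R, forall a, nrm (phi a) <= M * nrm a) ->
  nbhs x U -> 0 < e -> 0 <= n ->
  exists a, [/\ forall z, ~ U z -> gelfand a z = 0, nrm a <= e & n < nrm (phi a)].
Proof.
move=> unb nU e0 n0; have [b [V [oV Vx bV bU _]]] := local_unit nU.
have b0 : 0 < nrm b + 1 by have := nrm_ge0 b; lra.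
have [c cM] : exists c, n * (nrm b + 1) / e * nrm c < nrm (phi c).
  apply: contrapT => nc; apply: unb; exists (n * (nrm b + 1) / e) => a.
  by rewrite leNgt; apply/negP => ca; apply: nc; exists a.
have c0 : 0 < nrm c.
  apply: nrm_gt0; apply: contraTneq cM => ->.
  by rewrite (functional0 phi_lin) !nrm0 mulr0 ltxx.
pose k := e / ((nrm b + 1) * nrm c).
have k0 : 0 < k by rewrite divr_gt0 ?mulr_gt0.
have rk : nrm (k%:C : R[i]) = k by rewrite nrm_real gtr0_norm.
exists (k%:C *: bmul b c); split.
- move=> z nz; rewrite gelfandZ gelfandM (_ : gelfand b z = 0) ?mul0r ?mulr0 //.
  by apply/eqP/negPn/negP => bz; apply/nz/bU/subset_closure.
- rewrite nrmZ rk /k mulrAC ler_pdivrMr ?mulr_gt0 // ler_pM2l //.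
  apply: (le_trans (nrm_bmul _ _)); rewrite ler_pM2r //; lra.
rewrite (functionalZ phi_lin) nrmM rk.
have -> : phi (bmul b c) = phi c.
  apply: (@functional_eq_nbhs _ _ V); first exact: open_nbhs_nbhs.
  by move=> z /bV; rewrite gelfandM => ->; rewrite mul1r.
have -> : n = k * (n * (nrm b + 1) / e * nrm c).
  by rewrite /k; field; rewrite !gt_eqF.
by rewrite ltr_pM2l.
Qed.

End PointSupport.
End Localisation.


(** * Separating bijections *)

Lemma gelfand_sum_single (R : realType) (A : commBanachAlgType R)
    (a : nat -> A) s (c : R) n (z : char_space A) :
  (forall N, nrm (s - \sum_(k < N) a k) <= c / 2 ^+ N) ->
  (forall m, m != n -> gelfand (a m) z = 0) ->
  gelfand s z = gelfand (a n) z.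
Proof.
move=> sa a0; apply/eqP; rewrite -subr_eq0; apply/eqP/nrm_le_all_eq0 => e e0.
have [N Ne] := exp2V_small (2 * c) e0.
have partial M :
    gelfand (\sum_(k < M) a k) z = if (n < M)%N then gelfand (a n) z else 0.
  elim: M => [|M IH]; first by rewrite big_ord0 gelfand0.
  rewrite big_ord_recr /= gelfandD IH ltnS.
  have [nM|Mn|<-] := ltngtP n M; last by rewrite add0r.
    by rewrite (a0 M) ?addr0 // gtn_eqF.
  by rewrite (a0 M) ?addr0 // ltn_eqF.
have := partial (maxn n.+1 N); rewrite leq_maxl => <-; rewrite -gelfandB.
apply: (le_trans (gelfand_le _ _)).
have := sa (maxn n.+1 N); have := Ne _ (leq_maxr n.+1 N); rewrite -mulrA; lra.
Qed.

Section SeparatingBijection.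
Variables (R : realType) (A B : commBanachAlgType R) (T : {linear A -> B}).
Local Notation opcA := (one_point_compactification (char_space A)).
Hypotheses (MA : condition_M A) (ssA : semisimple A) (ssB : semisimple B).
Hypotheses (Tbij : bijective T) (Tsep : separating T).

Lemma linear_preimage b : exists a, T a = b.
Proof. by have [g _ gK] := Tbij; exists (g b). Qed.

Lemma tau_scalar y : scalar (tau T y).
Proof. by move=> k a b; rewrite /tau linearP gelfandD gelfandZ. Qed.

Lemma tau_nonzero y : exists a, tau T y a != 0.
Proof.
have [b b1] := gelfand_eq1 y; have [a Ta] := linear_preimage b.
by exists a; rewrite /tau Ta b1 oner_eq0.
Qed.

Lemma tau_supp_singleton y : exists p : opcA, functional_supp (tau T y) = [set p].
Proof.
have [p pS] := functional_supp_nonempty MA (tau_scalar y) (tau_nonzero y).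
exists p; apply/seteqP; split=> [q qS|_ ->] //.
apply: (functional_supp_atmost ssA _ qS pS) => a b /Tsep.
move=> /(congr1 (fun c => gelfand c y)); rewrite gelfandM gelfand0 => /eqP.
by rewrite mulf_eq0 => /orP[] /eqP; [left|right].
Qed.

Variable s : char_space B -> opcA.
Hypothesis supp_s : forall y, functional_supp (tau T y) = [set s y].

Let bounded_at y := exists M : R, forall a, nrm (tau T y a) <= M * nrm a.

(** A nonzero element living away from all the supports would have image 0. *)
Lemma support_dense (O : set (char_space A)) x0 : open O -> O x0 ->
  exists y x, s y = Some x /\ O x.
Proof.
move=> oO Ox0.
have [b [V [_ Vx0 bV bO cb]]] := local_unit MA (open_nbhs_nbhs (conj oO Ox0)).
apply: contrapT => nO.
have Tb : T b = 0.
  apply: ssB => y; apply: (functional_compact_away MA ssA (tau_scalar y) (supp_s y) cb).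
  by move=> x syx /bO Ox; apply: nO; exists y, x.
have : gelfand b x0 = 1 by exact: bV.
have [g gK _] := Tbij; rewrite -(gK b) Tb -(linear0 T) gK gelfand0 => /eqP.
by rewrite eq_sym oner_eq0.
Qed.

(** Gliding hump. If all functionals supported in [O] are unbounded, [O] has no
    isolated point, so one can go on for ever splitting off an open set [U]
    carrying a hump and a disjoint open set in which to continue. *)
Lemma bounded_support_dense (O : set (char_space A)) x0 : open O -> O x0 ->
  exists y x, [/\ bounded_at y, s y = Some x & O x].
Proof.
move=> oO Ox0; apply: contrapT => nO.
have unb y x : s y = Some x -> O x -> ~ bounded_at y.
  by move=> sy Ox by'; apply: nO; exists y, x.
(* A stage [n] splits [O' = p.2] into [U], carrying the hump [a], and [O1], where
   all later stages take place. *)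
pose good (O' : set (char_space A)) := [/\ open O', O' !=set0 & O' `<=` O].
have step (p : nat * set (char_space A)) :
    exists q : (set (char_space A) * char_space B) * (A * set (char_space A)),
    good p.2 -> let: ((U, y), (a, O1)) := q in
    [/\ [/\ good O1, O1 `<=` p.2, U `<=` p.2 & U `&` O1 = set0],
      [/\ open U & exists2 x, s y = Some x & U x],
      forall z, ~ U z -> gelfand a z = 0, nrm a <= 1 / 2 ^+ p.1
    & p.1%:R < nrm (tau T y a)].
  case: p => n O' /=; have [[oO' [z0 Oz0] OO]|] := pselect (good O'); last first.
    have [y _] := support_dense oO Ox0.
    by exists ((O', y), (0, O')).
  have [y [x [sy Ox]]] := support_dense oO' Oz0.
  have uy := unb y x sy (OO _ Ox).
  have sx : functional_supp (tau T y) = [set Some x] by rewrite supp_s sy.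
  have [x' Ox' x'x] : exists2 x', O' x' & x' != x.
    apply: contrapT => nx; apply: uy.
    apply: (functional_bounded_isolated MA ssA (tau_scalar y) sx).
    suff -> : [set x] = O' by [].
    apply/seteqP; split=> [_ -> //|z Oz].
    by apply/eqP/negPn/negP => zx; apply: nx; exists z.
  have [V [U [oV oU Vx' Ux VU]]] := char_space_separated x'x.
  have nU : nbhs x (U `&` O') by apply: open_nbhs_nbhs; split=> //; exact: openI.
  have e0 : 0 < 1 / 2 ^+ n :> R by rewrite divr_gt0 ?exprn_gt0.
  have [a [aU ae an]] :=
    functional_unbounded_local MA ssA (tau_scalar y) sx uy nU e0 (ler0n R n).
  exists ((U `&` O', y), (a, V `&` O')) => _; split=> //.
    split.
    - split; [exact: openI|by exists x'|by move=> z [_ /OO]].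
    - by move=> z [].
    - by move=> z [].
    - by rewrite -subset0 => z [[Uz _] [Vz _]]; rewrite -VU.
  by split; [exact: openI|exists x].
have [f fP] := choice step.
pose On := fix On n := if n is m.+1 then (f (m, On m)).2.2 else O.
pose Un n := (f (n, On n)).1.1; pose yn n := (f (n, On n)).1.2.
pose an n := (f (n, On n)).2.1.
have goodO n : good (On n).
  elim: n => [|n IH]; first by split=> //; exists x0.
  by have := fP (n, On n) IH => /=; case: (f _) => -[U y] [a O1] [[]].
have P n : [/\ [/\ On n.+1 `<=` On n, Un n `<=` On n & Un n `&` On n.+1 = set0],
      [/\ open (Un n) & exists2 x, s (yn n) = Some x & Un n x],
      forall z, ~ Un n z -> gelfand (an n) z = 0, nrm (an n) <= 1 / 2 ^+ n
    & n%:R < nrm (tau T (yn n) (an n))].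
  have := fP (n, On n) (goodO n); rewrite /Un /yn /an /=.
  by case: (f _) => -[U y] [a O1] /= [[]].
have mono m k : On (m + k)%N `<=` On m.
  elim: k => [|k IH]; first by rewrite addn0.
  by rewrite addnS; apply: subset_trans IH; have [[]] := P (m + k)%N.
have disj m n z : (m < n)%N -> Un m z -> Un n z -> False.
  move=> mn Um Un_z; have [[_ _ UO] _ _ _ _] := P m.
  suff : (Un m `&` On m.+1) z by rewrite UO.
  split=> //; apply: (mono m.+1 (n - m.+1)%N); rewrite subnKC //.
  by have [[_ UnO _] _ _ _ _] := P n; exact: UnO.
have an_small n : nrm (an n) <= 1 / 2 ^+ n by have [] := P n.
have [S SP] := geometric_sum an_small.
(* On [Un n] only the [n]-th hump is nonzero, so [S] and [an n] have the same germ
   at the support of [tau T (yn n)]. *)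
have big n : n%:R < 2 * nrm (T S).
  have [_ [oU [x sx Ux]] _ _ nan] := P n.
  apply: (lt_le_trans nan).
  have sx' : functional_supp (tau T (yn n)) = [set Some x] by rewrite supp_s sx.
  rewrite -(functional_eq_nbhs MA ssA (tau_scalar _) sx' (a := S) (V := Un n)).
  - exact: gelfand_le.
  - exact: open_nbhs_nbhs.
  move=> z Uz; apply: (gelfand_sum_single SP) => m mn.
  have [_ _ + _ _] := P m; apply=> Umz.
  move: mn; rewrite neq_ltn => /orP[mn|nm].
    exact: disj mn Umz Uz.
  exact: disj nm Uz Umz.
have := truncnS_gt (2 * nrm (T S)); apply/negP; rewrite -leNgt.
exact/ltW/big.
Qed.

(** For unbounded [tau T y0] the point [y0] has a neighbourhood disjoint from the
    bounded ones, on which regularity produces a nonzero [b]. Its preimage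
    vanishes at the supports of all the bounded functionals, a dense set. *)
Lemma tau_bounded : regular B ->
  exists M : R, forall y a, nrm (tau T y a) <= M * nrm a.
Proof.
move=> regB.
have [M MP] : exists M : R, forall (i : {y | bounded_at y}) a,
    nrm (tau T (sval i) a) <= M * nrm a.
  apply: uniform_boundedness.
  - by move=> i; exact: tau_scalar.
  - by move=> [].
  - by move=> a; exists (2 * nrm (T a)) => i; exact: gelfand_le.
exists M => y0 a; rewrite leNgt; apply/negP => ya.
have oU := open_gelfand_gt (T a) (M * nrm a).
have [b [b1 b0]] := regB y0 _ oU ya.
have [c Tc] := linear_preimage b.
have [x cx] : exists x, gelfand c x != 0.
  apply: contrapT => nc; have c0 : c = 0.
    by apply: ssA => x; apply/eqP/negPn/negP => cx; apply: nc; exists x.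
  by move/eqP: b1; rewrite -Tc c0 linear0 gelfand0 eq_sym oner_eq0.
have [y [x' [yb sy /negP cx']]] := bounded_support_dense (open_coz c) cx.
have sy' : functional_supp (tau T y) = [set Some x'] by rewrite supp_s sy.
have [e e1] := gelfand_eq1 x'; have [My yM] := yb.
have eval d := functional_bounded_eval MA ssA (tau_scalar y) sy' d yM e1.
have : tau T y c = 0.
  rewrite /tau Tc; apply: b0 => /=; apply/negP; rewrite -leNgt.
  exact: (MP (exist _ y yb)).
rewrite eval => /eqP; rewrite mulf_eq0 => /orP[|//] /eqP te.
by have [d] := tau_nonzero y; rewrite eval te mul0r eqxx.
Qed.

(** A functional supported at infinity annihilates the elements of compactly
    supported transform, which are dense. *)
Lemma support_finite y : tauberian A ->
  (exists M : R, forall a, nrm (tau T y a) <= M * nrm a) ->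
  exists x, s y = Some x.
Proof.
move=> [_ densA] [M yM]; case sy : (s y) => [x|]; first by exists x.
have [a /eqP ta] := tau_nonzero y; exfalso; apply: ta.
apply: nrm_le_all_eq0 => e e0.
have M0 : 0 < `|M| + 1 by rewrite ltr_wpDl.
have na : nbhs a [set c | nrm (c - a) < e / (`|M| + 1)].
  by apply/nbhs_nrm; exists (e / (`|M| + 1)); rewrite ?divr_gt0.
move: na; rewrite nbhsE => -[W [oW Wa] Wc].
have [c [/Wc /= ca cc]] : W `&` @compactly_supported R A !=set0.
  by apply: densA => //; exists a.
have tc : tau T y c = 0.
  apply: (functional_compact_away MA ssA (tau_scalar y) (supp_s y) cc) => x.
  by rewrite sy.
have -> : tau T y a = tau T y (a - c).
  by rewrite (functionalB (tau_scalar y)) tc subr0.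
apply: (le_trans (yM _)).
rewrite nrmC; move: ca; rewrite ltr_pdivlMr // => /ltW; apply: le_trans.
rewrite mulrC ler_wpM2l ?nrm_ge0 //; have := ler_norm M; lra.
Qed.

End SeparatingBijection.

(** * Weighted composition operators *)

Section WeightedComposition.
Variables (R : realType) (A B : commBanachAlgType R) (T : {linear A -> B}).
Variables (t : char_space B -> char_space A) (X : char_space B -> Cplx R).
Hypothesis TX : forall a y, gelfand (T a) y = X y * gelfand a (t y).

Lemma weighted_composition_closed : semisimple B ->
  forall (u : nat -> A) a b (c : R), (forall n, nrm (a - u n) <= c / 2 ^+ n) ->
    (forall n, nrm (b - T (u n)) <= c / 2 ^+ n) -> T a = b.
Proof.
move=> ssB u a b c ua Tub; apply/eqP; rewrite -subr_eq0; apply/eqP/ssB => y.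
apply: nrm_le_all_eq0 => e e0.
have [N /(_ N (leqnn _)) Ne] := exp2V_small ((nrm (X y) + 1) * (2 * c)) e0.
have -> : gelfand (T a - b) y =
    X y * gelfand (a - u N) (t y) - gelfand (b - T (u N)) y.
  by rewrite -TX -gelfandB linearB opprB addrA subrK.
apply: (le_trans (nrmB _ _)); rewrite nrmM.
have := ler_wpM2l (nrm_ge0 (X y)) (gelfand_le (a - u N) (t y)).
have := ler_wpM2l (nrm_ge0 (X y)) (ua N).
have := gelfand_le (b - T (u N)) y; have := Tub N.
have : (nrm (X y) + 1) * (2 * (c / 2 ^+ N)) < e by move: Ne; rewrite !mulrA.
move: (c / _) => q; lra.
Qed.

Hypotheses (T_surj : forall b, exists a, T a = b) (X_neq0 : forall y, X y != 0).

Lemma weighted_map_continuous : condition_M A -> continuous t.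
Proof.
move=> MA y U nU; have [b [V [_ Vy bV bU _]]] := local_unit MA nU.
have : nbhs y (coz (gelfand (T b))).
  apply: open_nbhs_nbhs; split; first exact: open_coz.
  by rewrite /coz /= TX bV // mulr1.
apply: filterS => z; rewrite /coz /= TX mulf_eq0 negb_or => /andP[_ bz].
by apply/bU/subset_closure.
Qed.

Lemma weighted_map_injective : regular B -> injective t.
Proof.
move=> regB y1 y2 ty; apply/eqP/negPn/negP => /char_space_separated.
move=> [U [V [oU oV Uy1 Vy2 UV]]].
have [b [b1 b0]] := regB y1 U oU Uy1.
have b2 : gelfand b y2 = 0.
  by apply: b0 => Uy2; suff : (U `&` V) y2 by rewrite UV.
have [a Ta] := T_surj b; move: b1 b2; rewrite -Ta !TX ty => b1 /eqP.
rewrite mulf_eq0 (negbTE (X_neq0 _)) /= => /eqP a0.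
by move/eqP: b1; rewrite a0 mulr0 eq_sym oner_eq0.
Qed.

(** Where [gelfand a (t y)] is not small, neither is [gelfand (T a) y], as [X] is
    bounded below; such [y] form a compact set, whose image is closed. Hence a
    point where [gelfand a] is 1 that is not attained has a neighbourhood missing
    the range of [t], which is dense. *)
Lemma weighted_map_surjective (m : R) :
  0 < m -> (forall y, m <= nrm (X y)) -> continuous t ->
  (forall (O : set (char_space A)) x, open O -> O x -> exists y, O (t y)) ->
  forall x, exists y, t y = x.
Proof.
move=> m0 Xge t_cont t_dense x; have [a a1] := gelfand_eq1 x.
pose K := [set y | m / 2 <= nrm (gelfand (T a) y)].
have cK : closed (t @` K).
  apply: compact_closed; first exact: char_space_hausdorff.
  apply: continuous_compact; first exact: continuous_subspaceT.
  by apply: gelfand_ge_compact; rewrite divr_gt0.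
have [[y _ yx]|nK] := pselect ((t @` K) x); first by exists y.
pose U := [set z | 2^-1 < nrm (gelfand a z)] `&` ~` (t @` K).
have oU : open U by apply: openI; [exact: open_gelfand_gt|exact: closed_openC].
have Ux : U x by split=> //=; rewrite a1 nrm1; lra.
have [y [ay nKy]] := t_dense U x oU Ux.
exfalso; apply: nKy; exists y => //; rewrite /K /= TX nrmM.
exact: ler_pM (ltW m0) (ltW _) (Xge y) (ltW ay).
Qed.

Lemma weighted_map_inverse_continuous h :
  regular B -> cancel h t -> continuous h.
Proof.
move=> regB hK x V; rewrite nbhsE => -[W [oW Wx] WV].
have [b [b1 b0]] := regB (h x) W oW Wx; have [a Ta] := T_surj b.
have : nbhs x (coz (gelfand a)).
  apply: open_nbhs_nbhs; split; first exact: open_coz.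
  by apply/eqP => a0; move/eqP: b1; rewrite -Ta TX hK a0 mulr0 eq_sym oner_eq0.
apply: filterS => z; rewrite /coz /= => az; apply: WV; apply: contrapT => nW.
have := b0 _ nW; rewrite -Ta TX hK => /eqP.
by rewrite mulf_eq0 (negbTE (X_neq0 _)) (negbTE az).
Qed.

Lemma weight_continuous : condition_M A -> continuous t -> continuous X.
Proof.
move=> MA t_cont y U nU.
have [b [V [oV Vy bV _ _]]] := local_unit MA (filterT : nbhs (t y) setT).
have nV : nbhs y [set z | V (t z)].
  by apply: (t_cont y V); exact: open_nbhs_nbhs.
have XT z : V (t z) -> X z = gelfand (T b) z by move=> Vz; rewrite TX bV ?mulr1.
have : nbhs y (gelfand (T b) @^-1` U).
  by apply: (@gelfand_continuous R B (T b) y U); rewrite -XT.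
by apply: filterS2 nV => z Vz; rewrite /= XT.
Qed.

Lemma weight_values_composition y :
  condition_M A -> weight_values T (t y) y = [set X y].
Proof.
move=> MA; apply/seteqP; split=> [_ [a [_ [U [nU _ aU]]] <-]|_ ->].
  by rewrite TX aU ?mulr1 //; exact: nbhs_singleton.
have [K nK cK] := compact_nbhs (t y).
have [b [V [oV Vy bV _ cb]]] := local_unit MA nK.
exists b; last by rewrite TX bV // mulr1.
split=> //; exists (V `&` K); split.
- by apply: filterI => //; exact: open_nbhs_nbhs.
- have clK : closed K := compact_closed (@char_space_hausdorff R A) cK.
  apply: subclosed_compact cK _; first exact: closed_closure.
  by move=> z /(closure_subset (@subIsetr _ V K)) /clK.
- by move=> z [/bV].
Qed.

End WeightedComposition.

Lemma uniformly_regular_unit (R : realType) (A : commBanachAlgType R) (D : R)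
    (x : char_space A) :
  uniformly_regular A D -> exists2 a, gelfand a x = 1 & nrm a < D + 1.
Proof.
move=> [_ /(_ x setT openT I) infD].
have [|_ [a [a1 _] <-]] := @ereal_inf_lt _ [set (rnorm a)%:E | a in
      [set a : A | gelfand a x = 1%R /\ supp (gelfand a) `<=` setT]] ((D + 1)%:E).
  by apply: (le_lt_trans infD); rewrite lte_fin ltrDl.
by rewrite lte_fin; exists a.
Qed.

(** * The representation theorem *)

Theorem theorem3p10 (R : realType) (DA DB : R)
    (A B : commBanachAlgType R) (T : {linear A -> B}) :
  0 < DA -> 0 < DB ->
  uniformly_regular A DA -> tauberian A -> condition_M A ->
  uniformly_regular B DB -> semisimple B -> condition_M B ->
  bijective T -> separating T ->
  continuous T /\
  nonvanishing T = [set: char_space B] /\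
  exists (t : char_space B -> char_space A) (X : char_space B -> Cplx R),
    [/\ is_support_map T (Some \o t) /\ homeomorphism t,
        is_weight T (Some \o t) X,
        (forall (a : A) (y : char_space B),
           gelfand (T a) y = X y * gelfand a (t y)),
        continuous X
      & (exists M : R, forall y, `|X y| <= M%:C) /\
        (exists2 m : R, 0 < m & forall y, m%:C <= `|X y|)].
Proof.
move=> DA0 DB0 urA tA MA urB ssB MB Tbij Tsep.
have [ssA _] := tA; have [regB _] := urB.
have [s supp_s] := choice (tau_supp_singleton MA ssA Tbij Tsep).
have [M0 tauM] := tau_bounded MA ssA ssB Tbij supp_s regB.
have /choice[t st] : forall y, exists x, s y = Some x.
  by move=> y; apply: (support_finite MA ssA Tbij supp_s tA); exists M0.
have supp_t y : functional_supp (tau T y) = [set Some (t y)].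
  by rewrite supp_s st.
have [e e1] := choice (fun y => gelfand_eq1 (t y)).
pose X y : Cplx R := tau T y (e y).
have TX a y : gelfand (T a) y = X y * gelfand a (t y).
  exact: (functional_bounded_eval MA ssA (tau_scalar T y) (supp_t y) a
    (tauM y) (e1 y)).
have [g gK Kg] := Tbij.
have g_lin : linear g by exact: can2_linear gK Kg.
pose G : {linear B -> A} := HB.pack g (GRing.isLinear.Build _ _ _ _ _ g_lin).
have closed_T := weighted_composition_closed TX ssB.
have [MT MT0 TM] : exists2 M : R, 0 <= M & forall a, nrm (T a) <= M * nrm a.
  by apply: closed_graph_bounded => u a b c ua Tub; exact: closed_T ua Tub.
have [MG MG0 GM] : exists2 M : R, 0 <= M & forall b, nrm (G b) <= M * nrm b.
  apply: closed_graph_bounded => u b a c ub Gua.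
  have <- : T a = b by apply: closed_T Gua _ => n /=; rewrite Kg.
  exact: gK.
have Xle y : nrm (X y) <= 2 * MT * (DA + 1).
  have [a a1 aD] := uniformly_regular_unit (t y) urA.
  have := gelfand_le (T a) y; rewrite TX a1 mulr1 => /le_trans; apply.
  rewrite -mulrA ler_pM2l //; apply: (le_trans (TM _)).
  by rewrite ler_wpM2l // ltW.
(* The lower bound for [X y] is the upper bound for the transform of the preimage
   of an element taking the value 1 at [y]. *)
pose m := (2 * (MG + 1) * (DB + 1))^-1.
have m0 : 0 < m by rewrite invr_gt0 !mulr_gt0 // ltr_wpDl // ltW.
have Xge y : m <= nrm (X y).
  have [b b1 bD] := uniformly_regular_unit y urB.
  have := TX (g b) y; rewrite Kg b1 => /(congr1 (@nrm R _)).
  rewrite nrm1 nrmM => Xb.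
  have gb : nrm (gelfand (g b) (t y)) <= m^-1.
    rewrite /m invrK; apply: (le_trans (gelfand_le _ _)).
    rewrite -mulrA ler_pM2l //; apply: (le_trans (GM _)).
    by apply: ler_pM; rewrite ?nrm_ge0 // ?lerDl // ltW.
  have mV0 : 0 < m^-1 by rewrite invr_gt0.
  rewrite -(ler_pM2r mV0) mulfV ?gt_eqF // Xb.
  by rewrite ler_wpM2l ?nrm_ge0.
have X0 y : X y != 0.
  by apply/eqP => Xy; have := Xge y; rewrite Xy nrm0 leNgt m0.
have T_surj b : exists a, T a = b by exists (g b).
have t_cont := weighted_map_continuous TX X0 MA.
have t_inj := weighted_map_injective TX T_surj X0 regB.
have /choice[h hK] : forall x, exists y, t y = x.
  apply: (weighted_map_surjective TX m0 Xge t_cont) => O x oO Ox.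
  have [y [z [+ Oz]]] := support_dense MA ssA ssB Tbij supp_s oO Ox.
  by rewrite st => -[tz]; exists y; rewrite tz.
have h_cont := weighted_map_inverse_continuous TX T_surj X0 regB hK.
split.
  move=> a U /nbhs_nrm[d d0 dU]; apply/nbhs_nrm.
  have MT1 : 0 < MT + 1 by rewrite ltr_wpDl.
  exists (d / (MT + 1)); first by rewrite divr_gt0.
  move=> b bd; apply: dU; rewrite -linearB; apply: (le_lt_trans (TM _)).
  move: bd; rewrite ltr_pdivlMr //; apply: le_lt_trans.
  by rewrite mulrC ler_wpM2l ?nrm_ge0 // lerDl.
split; first by apply/seteqP; split=> // y _; exact: tau_nonzero.
exists t, X; split=> //.
- split; first by move=> y _; exact: supp_t.
  split=> //; exists h; split=> //.
  by move=> y; apply: t_inj; rewrite hK.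
- by move=> y _ _ [<-]; exact: (weight_values_composition TX).
- exact: (weight_continuous TX).
- split; first by exists (2 * MT * (DA + 1)) => y; rewrite nrmE lecR.
  by exists m => // y; rewrite nrmE lecR.
Qed.
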